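(* Let $G\in\mathbb{R}^{n\times n}$ be symmetric positive definite and let $A\in\mathbb{R}^{n\times k}$ have full column rank. Let $(J,R)$ and $(\hat J,\hat R)$ be two pairs, each consisting of an $n\times n$ matrix and an upper triangular $k\times k$ matrix, and both satisfying $$J^{\top}GJ=I_n,\quad J^{\top}A=\begin{bmatrix}R\\0\end{bmatrix}\qquad\text{and}\qquad \hat J^{\top}G\hat J=I_n,\quad \hat J^{\top}A=\begin{bmatrix}\hat R\\0\end{bmatrix}$$ for the same $G$ and $A$. For $n_*\in\mathbb{R}^n$ put $$d=J^{\top}n_*,\qquad z=J_2d_2,\qquad r=R^{-1}d_1,$$ where $J=[\,J_1\ \ J_2\,]$ with $J_1\in\mathbb{R}^{n\times k}$, and $d=(d_1,d_2)$ with $d_1\in\mathbb{R}^k$, and define $\hat d,\hat z,\hat r$ in the same way from $(\hat J,\hat R)$. Then for every $n_*\in\mathbb{R}^n$, $\hat z=z$ and $\hat r=r$. Moreover, if the two representations are related by $\hat J_1=J_1S$, $\hat J_2=J_2$, $\hat R=SR$ with $S$ a diagonal matrix with diagonal entries $\pm1$, then the equalities $\hat z=z$ and $\hat r=r$ hold exactly in IEEE 754 arithmetic.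
   Context: In the final assertion, the quantities compared are the floating-point values computed from the formulas $d=J^{\top}n_*$, $z=J_2d_2$, and $r=R^{-1}d_1$ (triangular solve), evaluated by the same sequence of IEEE 754 operations for each of the two representations. In the source, $A$ is the matrix of the normals of the working-set constraints of a quadratic program with Hessian $G$, and $n_*$ is the normal of an entering constraint. *)

(* Defs.v *)
From HB Require Import structures.
From Stdlib Require Import ZArith.
From Stdlib Require Export SpecFloat.
From mathcomp Require Export all_boot all_order all_algebra.
From mathcomp Require Export ssrZ reals.

Set Implicit Arguments.
Unset Strict Implicit.
Unset Printing Implicit Defensive.

Import Order.TTheory GRing.Theory Num.Theory.
Local Open Scope ring_scope.

(* Full column rank forces k <= n, so n is written k + m throughout; the blocks
   J_1, J_2 are then lsubmx J, rsubmx J and d_1, d_2 are usubmx d, dsubmx d. *)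

Section Exact.
Variable R : realType.

Definition spd n (G : 'M[R]_n) : Prop :=
  G^T = G /\ forall x : 'cV[R]_n, x != 0 -> 0 < (x^T *m G *m x) 0 0.

(* is_trig_mx is lower triangularity. *)
Definition upper_triangular k (T : 'M[R]_k) : bool := is_trig_mx T^T.

Definition representation k m (G : 'M[R]_(k + m)) (A : 'M[R]_(k + m, k))
    (J : 'M[R]_(k + m)) (T : 'M[R]_k) : Prop :=
  [/\ upper_triangular T, J^T *m G *m J = 1%:M & J^T *m A = col_mx T 0].

Definition vec_d k m (J : 'M[R]_(k + m)) (nstar : 'cV[R]_(k + m)) :
  'cV[R]_(k + m) := J^T *m nstar.

Definition vec_z k m (J : 'M[R]_(k + m)) (nstar : 'cV[R]_(k + m)) :
  'cV[R]_(k + m) := rsubmx J *m dsubmx (vec_d J nstar).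

Definition vec_r k m (J : 'M[R]_(k + m)) (T : 'M[R]_k)
    (nstar : 'cV[R]_(k + m)) : 'cV[R]_k :=
  invmx T *m usubmx (vec_d J nstar).

(* Infinities and NaN get the junk value 0; SFval is only used on SFfinite
   data. *)
Definition SFval (x : spec_float) : R :=
  match x with
  | S754_finite s p e => (-1) ^+ s * (Pos.to_nat p)%:R * 2%:R ^ int_of_Z e
  | _ => 0
  end.

End Exact.

(* IEEE 754 binary arithmetic is that of SpecFloat: precision prec, overflow
   threshold 2 ^ emax, rounding to nearest with ties to even (binary64 is
   prec = 53, emax = 1024), one NaN. *)
Definition float_format (prec emax : Z) : Prop := Z.lt 0 prec /\ Z.lt prec emax.

Definition SFfinite (prec emax : Z) (x : spec_float) : bool :=
  match x with
  | S754_zero _ => true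
  | S754_finite _ _ _ => valid_binary prec emax x
  | _ => false
  end.

(* x and y are the same datum up to the sign of a zero; on numbers this is
   IEEE equality, and NaN only matches NaN. The sign of zero has to be ignored:
   an exact cancellation rounds to +0 both for x - x and for its opposite
   (- x) + x, so flipping signs in a sum need not flip the sign of a zero
   result. *)
Definition SFsame (x y : spec_float) : Prop :=
  match x, y with
  | S754_zero _, S754_zero _ => True
  | _, _ => x = y
  end.

(* Fused multiply-add x * y + z with one rounding, absent from SpecFloat.
   SFadd rounds the exact sum of two nonzero finite operands even if these are
   not in the format, so it can be given the exact product; it returns the
   other operand unrounded when one is zero, hence the separate case. *)
Definition SFfma (prec emax : Z) (x y z : spec_float) : spec_float :=
  match x, y, z with
  | S754_finite _ _ _, S754_finite _ _ _, S754_zero _ => SFmul prec emax x y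
  | S754_finite sx mx ex, S754_finite sy my ey, _ =>
      SFadd prec emax
        (S754_finite (xorb sx sy) (Pos.mul mx my) (Z.add ex ey)) z
  | _, _, _ => SFadd prec emax (SFmul prec emax x y) z
  end.

(* A way of evaluating a sum of c (an initial value) and of terms +- a_i * b_i
   by floating-point operations, in any order and association, with or without
   fused multiply-adds. *)
Inductive sumexp (I : Type) : Type :=
| SumZero
| SumInit
| SumProd of I
| SumOpp of sumexp I
| SumAdd of sumexp I & sumexp I
| SumSub of sumexp I & sumexp I
| SumFma of bool & I & sumexp I.

Arguments SumZero {I}.
Arguments SumInit {I}.

Fixpoint sum_eval (prec emax : Z) (I : Type) (c : spec_float)
    (a b : I -> spec_float) (t : sumexp I) : spec_float :=
  let ev := sum_eval prec emax c a b in
  match t with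
  | SumZero => S754_zero false
  | SumInit => c
  | SumProd i => SFmul prec emax (a i) (b i)
  | SumOpp t1 => SFopp (ev t1)
  | SumAdd t1 t2 => SFadd prec emax (ev t1) (ev t2)
  | SumSub t1 t2 => SFsub prec emax (ev t1) (ev t2)
  | SumFma neg i t1 =>
      SFfma prec emax (if neg then SFopp (a i) else a i) (b i) (ev t1)
  end.

(* The terms of the sum evaluated by t, with their signs (true is minus):
   None stands for c and Some i for a_i * b_i. *)
Fixpoint sum_terms (I : Type) (t : sumexp I) : seq (bool * option I) :=
  let flip := map (fun u : bool * option I => (~~ u.1, u.2)) in
  match t with
  | SumZero => [::]
  | SumInit => [:: (false, None)]
  | SumProd i => [:: (false, Some i)]
  | SumOpp t1 => flip (sum_terms t1)
  | SumAdd t1 t2 => sum_terms t1 ++ sum_terms t2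
  | SumSub t1 t2 => sum_terms t1 ++ flip (sum_terms t2)
  | SumFma neg i t1 => (neg, Some i) :: sum_terms t1
  end.

Definition dot_scheme n (t : sumexp 'I_n) : bool :=
  perm_eq (sum_terms t) [seq (false, Some i) | i <- enum 'I_n].

(* d_i - sum_(j > i) T_ij r_j, the numerator of step i of back substitution. *)
Definition row_scheme k (i : 'I_k) (t : sumexp 'I_k) : bool :=
  perm_eq (sum_terms t)
    ((false, None) :: [seq (true, Some j) | j : 'I_k <- enum 'I_k & (i < j)%N]).

Section Float.
Variables prec emax : Z.

Definition fl_mulmxv p q (t : 'I_p -> sumexp 'I_q) (M : 'M[spec_float]_(p, q))
    (v : 'cV[spec_float]_q) : 'cV[spec_float]_p :=
  \col_i sum_eval prec emax (S754_zero false) (M i) (v^~ 0) (t i).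

(* Back substitution: foldr treats the last row first, and step i only reads
   the entries r_j with j > i, already computed. *)
Definition fl_solve k (t : 'I_k -> sumexp 'I_k) (T : 'M[spec_float]_k)
    (d : 'cV[spec_float]_k) : 'cV[spec_float]_k :=
  foldr
    (fun (i : 'I_k) (r : 'cV[spec_float]_k) => \col_j
       if j == i then
         SFdiv prec emax (sum_eval prec emax (d i 0) (T i) (r^~ 0) (t i)) (T i i)
       else r j 0)
    (const_mx (S754_zero false)) (enum 'I_k).

Definition fl_d k m (td : 'I_(k + m) -> sumexp 'I_(k + m))
    (J : 'M[spec_float]_(k + m)) (nstar : 'cV[spec_float]_(k + m)) :
  'cV[spec_float]_(k + m) := fl_mulmxv td J^T nstar.

Definition fl_z k m (td : 'I_(k + m) -> sumexp 'I_(k + m))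
    (tz : 'I_(k + m) -> sumexp 'I_m) (J : 'M[spec_float]_(k + m))
    (nstar : 'cV[spec_float]_(k + m)) : 'cV[spec_float]_(k + m) :=
  fl_mulmxv tz (rsubmx J) (dsubmx (fl_d td J nstar)).

Definition fl_r k m (td : 'I_(k + m) -> sumexp 'I_(k + m))
    (tr : 'I_k -> sumexp 'I_k) (J : 'M[spec_float]_(k + m))
    (T : 'M[spec_float]_k) (nstar : 'cV[spec_float]_(k + m)) :
  'cV[spec_float]_k :=
  fl_solve tr T (usubmx (fl_d td J nstar)).

End Float.

Definition SFfinite_mx (prec emax : Z) p q (M : 'M[spec_float]_(p, q)) : Prop :=
  forall i j, SFfinite prec emax (M i j).

(* Main.v *)
(* Exact arithmetic: J J^T = G^-1, hence T^T T = A^T G^-1 A, where T is the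
   triangular factor, and J_1 = G^-1 A T^-1. Therefore z = (J J^T - J_1 J_1^T) n_*
   and r = (T^T T)^-1 A^T G^-1 n_* depend on G and A only.

   Floating-point arithmetic: rounding to nearest is symmetric, so negating an
   operand of a product or quotient, or all operands of a sum, negates the
   result, up to the sign of a zero. Hence d_1 is multiplied by S and d_2 is
   unchanged. In step i of back substitution the numerator and the pivot T_ii
   are both multiplied by S_ii, and T_ii is nonzero, so the quotient is
   unchanged. *)
Require Import Defs.
From Stdlib Require Import ZArith.
From mathcomp Require Import zify lra.

Set Implicit Arguments.
Unset Strict Implicit.
Unset Printing Implicit Defensive.

Import Order.TTheory GRing.Theory Num.Theory.
Local Open Scope ring_scope.

(** * Exact arithmetic: $z$ and $r$ expressed through $JJ^{\top}$ and $A$ *)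

Section ExactArithmetic.
Context {F : realType} {k m : nat} (G : 'M[F]_(k + m)) (A : 'M[F]_(k + m, k)).
Hypothesis rankA : \rank A = k.

Lemma representation_JJt J T :
  representation G A J T -> J *m J^T *m G = 1%:M.
Proof. by case=> _ JGJ _; rewrite -mulmxA; apply: mulmx1C. Qed.

(** Multiply $J^{\top}A$ by $GJ=(J^{\top})^{-1}$; the zero block removes $J_2$. *)
Lemma representation_A J T :
  representation G A J T -> A = G *m lsubmx J *m T.
Proof.
move=> rJ; have JJG := representation_JJt rJ; case: rJ => _ _ JA.
have GJJ : G *m J *m J^T = 1%:M by rewrite -mulmxA; apply: mulmx1C.
rewrite -[LHS]mul1mx -GJJ -mulmxA JA -[J in LHS]hsubmxK -!mulmxA.
by rewrite mul_row_col mulmx0 addr0.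
Qed.

(** [A] factors through [T] on the right, so the rank $k$ of [A] bounds that of the square matrix
    [T] from below. *)
Lemma representation_unitmx J T : representation G A J T -> T \in unitmx.
Proof.
move=> rJ; rewrite -row_free_unit -row_leq_rank -{1}rankA.
by rewrite (representation_A rJ) mxrankM_maxr.
Qed.

Lemma representation_gram J T :
  representation G A J T -> T^T *m T = A^T *m (J *m J^T) *m A.
Proof.
case=> _ _ JA; rewrite -!mulmxA JA mulmxA -[A^T *m J]trmxK trmx_mul trmxK JA.
by rewrite tr_col_mx mul_row_col mulmx0 addr0.
Qed.

Lemma representation_J1 J T :
  representation G A J T -> lsubmx J = J *m J^T *m A *m invmx T.
Proof.
move=> rJ; rewrite [X in _ *m X *m _](representation_A rJ) !mulmxA.
by rewrite (representation_JJt rJ) mul1mx mulmxK // (representation_unitmx rJ).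
Qed.

Lemma JJt_unique J Jh T Th :
  representation G A J T -> representation G A Jh Th -> Jh *m Jh^T = J *m J^T.
Proof.
move=> rJ rJh; have GJJ := mulmx1C (representation_JJt rJ).
by rewrite -[LHS]mulmx1 -GJJ mulmxA (representation_JJt rJh) mul1mx.
Qed.

(** Since $A^{\top}J=[\,T^{\top}\ 0\,]$, the vector $r$ solves the normal equations
    $T^{\top}T\,r=T^{\top}d_1=A^{\top}JJ^{\top}n$. *)
Lemma exact_vec_r J T n : representation G A J T ->
  vec_r J T n = invmx (A^T *m (J *m J^T) *m A) *m (A^T *m (J *m J^T) *m n).
Proof.
move=> rJ; have uT := representation_unitmx rJ; rewrite -(representation_gram rJ).
have JA : A^T *m J = row_mx T^T 0.
  by case: rJ => _ _ JA; rewrite -[LHS]trmxK trmx_mul trmxK JA tr_col_mx trmx0.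
have -> : A^T *m (J *m J^T) *m n = T^T *m usubmx (vec_d J n).
  by rewrite -!mulmxA mulmxA JA -[J^T *m n]vsubmxK mul_row_col mul0mx addr0.
have uTT : T^T *m T \in unitmx by rewrite unitmx_mul unitmx_tr uT.
have <- : T^T *m T *m vec_r J T n = T^T *m usubmx (vec_d J n).
  by rewrite /vec_r mulmxA mulmxK.
by rewrite mulKmx.
Qed.

(** Here $J_2J_2^{\top}=JJ^{\top}-J_1J_1^{\top}$, and $J_1=JJ^{\top}AT^{-1}$ makes $T$ enter only
    through $T^{-1}T^{-\top}=(T^{\top}T)^{-1}$. *)
Lemma exact_vec_z J T n : representation G A J T ->
  vec_z J n = (J *m J^T - J *m J^T *m A *m invmx (A^T *m (J *m J^T) *m A)
               *m A^T *m (J *m J^T)) *m n.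
Proof.
move=> rJ; have uT := representation_unitmx rJ; rewrite -(representation_gram rJ).
have -> : vec_z J n = (J *m J^T - lsubmx J *m (lsubmx J)^T) *m n.
  rewrite /vec_z /vec_d -[J in _ = (J *m _ - _) *m _]hsubmxK -[J in J^T]hsubmxK.
  rewrite tr_row_mx mul_row_col addrAC subrr add0r mul_col_mx col_mxKd.
  by rewrite mulmxA.
congr ((_ - _) *m _).
have -> : invmx (T^T *m T) = invmx T *m (invmx T)^T.
  have uTT : T^T *m T \in unitmx by rewrite unitmx_mul unitmx_tr uT.
  have VTT : T^T *m T *m (invmx T *m (invmx T)^T) = 1%:M.
    by rewrite -mulmxA mulKVmx // -trmx_mul mulVmx // trmx1.
  by rewrite -[RHS](mulKmx uTT) VTT mulmx1.
by rewrite (representation_J1 rJ) !trmx_mul trmxK !mulmxA.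
Qed.

End ExactArithmetic.

(* In relations of the form SFsame x' (SFsgn b x), one sign b accounts for the
   change of representation, and SFsame for the signs of zeros, on which only a
   division by zero could depend. *)
Definition SFsgn (b : bool) (x : spec_float) : spec_float :=
  if b then SFopp x else x.

(** * Sign symmetry of the floating-point operations *)

Section SignSymmetry.
Variables prec emax : Z.
Local Notation add := (SFadd prec emax).
Local Notation mul := (SFmul prec emax).
Local Notation div := (SFdiv prec emax).

Lemma SFsame_refl x : SFsame x x.
Proof. by case: x. Qed.

Lemma SFsame_trans x y z : SFsame x y -> SFsame y z -> SFsame x z.
Proof.
case: x => [?|?||???]; case: y => [?|?||???] //=;
  by [case: z|move=> ->].
Qed.

Lemma SFsameP x y :
  SFsame x y -> x = y \/ exists b c, x = S754_zero b /\ y = S754_zero c.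
Proof.
by case: x => [b|?||???]; case: y => [c|?||???] //= e; [right; exists b, c|left..].
Qed.

Lemma SFsgn_same b x y : SFsame x y -> SFsame (SFsgn b x) (SFsgn b y).
Proof.
case/SFsameP => [->|[u [v [-> ->]]]]; first exact: SFsame_refl.
by case: b.
Qed.

Lemma SFoppK : involutive SFopp.
Proof. by case=> [b|b||b p e] //=; rewrite negbK. Qed.

Lemma SFsgnK b : involutive (SFsgn b).
Proof. by case: b => //=; apply: SFoppK. Qed.

(** Rounding works on mantissa and exponent alone; the sign is only copied to the result. *)
Lemma binary_round_aux_opp s n e l :
  binary_round_aux prec emax (~~ s) n e l =
  SFopp (binary_round_aux prec emax s n e l).
Proof.
rewrite /binary_round_aux; case: shr_fexp => r e1; case: shr_fexp => r2 e2.
by case: (shr_m r2) => // p; case: ifP.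
Qed.

(** The flags [z] and [z'] give the sign of an exact zero, so they may be unrelated: [SFsame]
    absorbs them when [n] is zero. *)
Lemma binary_normalize_opp n e z z' :
  SFsame (binary_normalize prec emax (Z.opp n) e z')
    (SFopp (binary_normalize prec emax n e z)).
Proof.
by case: n => [|p|p] //=; rewrite /binary_round; case: shl_align => q e';
  rewrite -binary_round_aux_opp; apply: SFsame_refl.
Qed.

Lemma SFadd_same x x' y y' :
  SFsame x x' -> SFsame y y' -> SFsame (add x y) (add x' y').
Proof.
case/SFsameP => [->|[u [v [-> ->]]]]; case/SFsameP => [->|[w [t [-> ->]]]].
- exact: SFsame_refl.
- by case: x' => [[]|?||???]; case: w; case: t.
- by case: y' => [[]|?||???]; case: u; case: v.
- by case: u v w t => [] [] [] [].
Qed.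

Lemma cond_Zopp_negb b n : cond_Zopp (~~ b) n = Z.opp (cond_Zopp b n).
Proof. by case: b => //=; rewrite Z.opp_involutive. Qed.

Lemma SFadd_opp x y : SFsame (add (SFopp x) (SFopp y)) (SFopp (add x y)).
Proof.
case: x => [[]|[]||s p e]; case: y => [[]|[]||s' p' e'] //.
rewrite /= !cond_Zopp_negb -Z.opp_add_distr.
exact: binary_normalize_opp.
Qed.

Lemma SFadd_sgn b x x' y y' :
  SFsame x' (SFsgn b x) -> SFsame y' (SFsgn b y) ->
  SFsame (add x' y') (SFsgn b (add x y)).
Proof.
move=> hx hy; apply: SFsame_trans (SFadd_same hx hy) _.
by case: b {hx hy} => /=; [apply: SFadd_opp|apply: SFsame_refl].
Qed.

Lemma SFsubE x y : SFsub prec emax x y = add x (SFopp y).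
Proof.
case: x => [[]|[]||s p e]; case: y => [[]|[]||s' p' e'] //=.
all: by rewrite ?cond_Zopp_negb ?Z.add_opp_r.
Qed.

Lemma SFmul_same x x' y y' :
  SFsame x x' -> SFsame y y' -> SFsame (mul x y) (mul x' y').
Proof.
case/SFsameP => [->|[u [v [-> ->]]]]; case/SFsameP => [->|[w [t [-> ->]]]] //.
- exact: SFsame_refl.
- by case: x'.
- by case: y'.
Qed.

Lemma SFmul_oppl x y : mul (SFopp x) y = SFopp (mul x y).
Proof.
by case: x => [[]|[]||[] p e]; case: y => [[]|[]||[] p' e'] //=;
  rewrite -binary_round_aux_opp.
Qed.

Lemma SFmul_sgn b x x' y y' :
  SFsame x' (SFsgn b x) -> SFsame y' y -> SFsame (mul x' y') (SFsgn b (mul x y)).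
Proof.
move=> hx hy; apply: SFsame_trans (SFmul_same hx hy) _.
by case: b {hx} => /=; rewrite ?SFmul_oppl; apply: SFsame_refl.
Qed.

Lemma SFsub_sgn b x x' y y' :
  SFsame x' (SFsgn b x) -> SFsame y' (SFsgn b y) ->
  SFsame (SFsub prec emax x' y') (SFsgn b (SFsub prec emax x y)).
Proof.
move=> hx hy; rewrite !SFsubE; apply: SFadd_sgn => //.
by have := SFsgn_same true hy; case: b {hx hy}.
Qed.

Local Notation fma := (SFfma prec emax).

(** The unrounded product, possibly outside the format: with a nonzero addend, a fused multiply-add
    is one [SFadd] applied to it. *)
Definition exact_mul (x y : spec_float) : spec_float :=
  match x, y with
  | S754_finite s p e, S754_finite s' p' e' =>
      S754_finite (xorb s s') (Pos.mul p p') (Z.add e e')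
  | _, _ => mul x y
  end.

Lemma exact_mul_sgn b x x' y y' :
  SFsame x' (SFsgn b x) -> SFsame y' y ->
  SFsame (exact_mul x' y') (SFsgn b (exact_mul x y)).
Proof.
case/SFsameP => [->|[u [v [-> ex]]]]; case/SFsameP => [->|[w [t [-> ->]]]].
- by case: b; case: x => [[]|[]||[] p e]; case: y => [[]|[]||[] p' e'].
- by case: b; case: x => [[]|[]||[] p e].
- by rewrite -[x](SFsgnK b) ex; case: b {ex}; case: y => [[]|[]||[] p' e'].
- by rewrite -[x](SFsgnK b) ex; case: b {ex}.
Qed.

Lemma SFfma_zero x y b : SFsame (fma x y (S754_zero b)) (mul x y).
Proof.
have add0 u : SFsame (add u (S754_zero b)) u by case: u b => [[]|[]||s p e] [].
by case: x => [s|s||s p e]; case: y => [s'|s'||s' p' e'];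
  first [exact: SFsame_refl | exact: add0].
Qed.

Lemma SFfma_nonzero x y z :
  (if z is S754_zero _ then False else True) ->
  fma x y z = add (exact_mul x y) z.
Proof.
by case: z => [s|s||s p e] // _; case: x => [s1|s1||s1 p1 e1];
  case: y => [s2|s2||s2 p2 e2].
Qed.

Lemma SFfma_sgn b x x' y y' z z' :
  SFsame x' (SFsgn b x) -> SFsame y' y -> SFsame z' (SFsgn b z) ->
  SFsame (fma x' y' z') (SFsgn b (fma x y z)).
Proof.
move=> hx hy hz; have hs := SFadd_sgn (exact_mul_sgn hx hy) hz.
(* A zero addend forces [z'] to be zero too, and both sides reduce to rounded products; otherwise
   both are sums with an exact product. *)
case: z => [c|c||c p e] in hz hs *.
  have [d ->] : exists d, z' = S754_zero d.
    by move: hz; case: (b) => /=; case: z' {hs} => //= d; exists d.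
  apply: SFsame_trans (SFfma_zero _ _ _) _.
  apply: SFsame_trans (SFmul_sgn hx hy) _.
  apply: SFsgn_same; have := SFfma_zero x y c.
  by case: (mul x y) => [?|?||? ? ?]; case: (fma _ _ _).
all: by rewrite !SFfma_nonzero //; move: hz; case: (b); case: z' {hs}.
Qed.

Lemma SFdiv_sgn b b' x x' y y' :
  SFsame x' (SFsgn b x) -> y' = SFsgn b' y ->
  (if y is S754_finite _ _ _ then True else False) ->
  SFsame (div x' y') (SFsgn (b (+) b') (div x y)).
Proof.
move=> hx ->; case: y => // s p e _.
case/SFsameP: hx => [->|[u [v [-> ex]]]]; last first.
  by rewrite -[x](SFsgnK b) ex; case: b {ex}; case: b'.
case: x => [[]|[]||[] p' e']; case: s; case: b; case: b' => //=.
all: case: SFdiv_core_binary => [[q r] l]; rewrite -?binary_round_aux_opp.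
all: exact: SFsame_refl.
Qed.

(** One sign [b] is shared by all leaves of [t], so it passes through every node, whatever the order
    and association. *)
Lemma sum_eval_sgn b (I : Type) c c' (u u' v v' : I -> spec_float) t :
  SFsame c' (SFsgn b c) -> (forall i, SFsame (u' i) (SFsgn b (u i))) ->
  (forall i, SFsame (v' i) (v i)) ->
  SFsame (sum_eval prec emax c' u' v' t) (SFsgn b (sum_eval prec emax c u v t)).
Proof.
move=> hc hu hv; elim: t => [||i|t IH|t IH t' IH'|t IH t' IH'|neg i t IH] //=.
- by case: b {hc hu}.
- exact: SFmul_sgn.
- by have := SFsgn_same true IH; case: b {hc hu IH}.
- exact: SFadd_sgn.
- exact: SFsub_sgn.
- apply: SFfma_sgn => //; have := SFsgn_same neg (hu i).
  by case: neg; case: b {hc hu IH}.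
Qed.

Lemma fl_mulmxv_sgn p q (t : 'I_p -> sumexp 'I_q)
    (M M' : 'M[spec_float]_(p, q)) (v v' : 'cV[spec_float]_q) b i :
  (forall j, SFsame (M' i j) (SFsgn b (M i j))) ->
  (forall j, SFsame (v' j 0) (v j 0)) ->
  SFsame (fl_mulmxv prec emax t M' v' i 0)
         (SFsgn b (fl_mulmxv prec emax t M v i 0)).
Proof. by move=> hM hv; rewrite !mxE; apply: sum_eval_sgn => //; case: b {hM}. Qed.

(* Scaling a row by -1 negates both operands of the division of that row. *)
Lemma fl_solve_sgn k (t : 'I_k -> sumexp 'I_k)
    (T T' : 'M[spec_float]_k) (d d' : 'cV[spec_float]_k) (b : 'I_k -> bool) :
  (forall i j, SFsame (T' i j) (SFsgn (b i) (T i j))) ->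
  (forall i, SFsame (d' i 0) (SFsgn (b i) (d i 0))) ->
  (forall i, if T i i is S754_finite _ _ _ then True else False) ->
  forall i, SFsame (fl_solve prec emax t T' d' i 0) (fl_solve prec emax t T d i 0).
Proof.
move=> hT hd nzT; rewrite /fl_solve; elim: (enum 'I_k) => [|l ls IH] i.
  by rewrite /= !mxE.
rewrite /= !mxE; case: eqP => _ //.
(* The signs of numerator and pivot cancel; this puts the goal in the form of [SFdiv_sgn]. *)
have sgn_bb x : x = SFsgn (b l (+) b l) x by rewrite addbb.
rewrite [X in SFsame _ X]sgn_bb.
apply: SFdiv_sgn; [|move: (hT l l)|exact: nzT].
  by apply: sum_eval_sgn; [apply: hd|apply: hT|apply: IH].
(* For a nonzero pivot, [SFsame] is equality. *)
have := nzT l; case: (T l l) => // s p e _.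
by case: (b l) => /=; case: (T' l l) => //=.
Qed.

End SignSymmetry.

(** * Recovering a float from its real value *)

Lemma digits2_iter n p :
  Z.pos (digits2_pos (ssrnat.iter n xO p)) =
  Z.add (Z.pos (digits2_pos p)) (Z.of_nat n).
Proof. by elim: n => [|n IH]; rewrite ?iterS /=; lia. Qed.

Lemma to_nat_iter n p : Pos.to_nat (ssrnat.iter n xO p) =
  muln (Pos.to_nat p) (expn 2 n).
Proof. by elim: n => [|n IH]; rewrite ?muln1 // expnS iterS; lia. Qed.

Section Values.
Variables (F : realType) (prec emax : Z).
Local Notation val := (@SFval F).
Local Notation finite := (SFfinite prec emax).

Lemma SFval_sgn (b : bool) x : val (SFsgn b x) = (-1) ^+ b * val x.
Proof.
case: b; rewrite ?expr1 ?expr0 ?mul1r // mulN1r.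
by case: x => [s|s||[] p e] /=;
  rewrite ?oppr0 // expr0 expr1 !mulN1r !mul1r ?mulNr ?opprK.
Qed.

Lemma SFfinite_sgn b x : finite (SFsgn b x) = finite x.
Proof. by case: b; case: x. Qed.

Local Notation scaled p e := ((Pos.to_nat p)%:R * 2%:R ^ int_of_Z e : F).

Lemma scaled_gt0 p e : 0 < scaled p e.
Proof. by rewrite mulr_gt0 ?exprz_gt0 // ltr0n; lia. Qed.

(* The real value determines the number of digits plus the exponent, hence, for a
   canonical mantissa, the exponent. *)
Lemma canonical_uniq_le p p' e e' : Z.le e e' ->
  canonical_mantissa prec emax p e -> canonical_mantissa prec emax p' e' ->
  scaled p e = scaled p' e' -> p = p' /\ e = e'.
Proof.
move=> le_ee' /Z.eqb_spec ce /Z.eqb_spec ce' eq_pp'.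
pose n := Z.to_nat (Z.sub e' e); have e'E : e' = Z.add e (Z.of_nat n) by lia.
(* Equal values force the mantissa with the smaller exponent to be the other one shifted by [n]
   bits. *)
have pE : p = ssrnat.iter n xO p'.
  apply: Pos2Nat.inj; rewrite to_nat_iter; apply/eqP; rewrite -(eqr_nat F).
  have E : int_of_Z e' = int_of_Z e + n%:Z by lia.
  have u2 : (2 : F) != 0 by rewrite pnatr_eq0.
  move: eq_pp'; rewrite E expfzDr // mulrCA mulrA -mulrA [LHS]mulrC => /mulfI.
  by rewrite natrM natrX => ->//; rewrite expfz_neq0.
have eE : e = e'.
  by rewrite -ce -[RHS]ce' pE digits2_iter e'E; congr fexp; lia.
by move: pE; have -> : n = 0%nat by lia.
Qed.

Lemma canonical_uniq p p' e e' :
  canonical_mantissa prec emax p e -> canonical_mantissa prec emax p' e' ->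
  scaled p e = scaled p' e' -> p = p' /\ e = e'.
Proof.
move=> c c' eq_pp'; have [le_ee'|le_e'e] : Z.le e e' \/ Z.le e' e by lia.
  exact: canonical_uniq_le.
by have [-> ->] := canonical_uniq_le le_e'e c' c (esym eq_pp').
Qed.

Lemma SFval_eq0 x : finite x ->
  val x = 0 -> exists b, x = S754_zero b.
Proof.
case: x => [b|b||b p e] //= _; first by exists b.
by move/eqP; rewrite -mulrA mulf_eq0 signr_eq0 gt_eqF // scaled_gt0.
Qed.

(** Turns relations between real values into relations between data; only the sign of a zero is
    lost. *)
Lemma SFval_inj x y : finite x -> finite y -> val x = val y -> SFsame x y.
Proof.
move=> fx fy exy; case: y fy exy => [c|//|//|s p e] fy exy.
  by have [b ->] := SFval_eq0 fx exy.
case: x fx exy => [c|//|//|s' p' e'] fx exy.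
  by have [b] := SFval_eq0 fy (esym exy).
have /andP[cy _] := fy; have /andP[cx _] := fx.
move: exy => /= exy.
(* The scaled mantissas are positive, so the sign bit is the sign of the value. *)
have ss' : s' = s.
  have := scaled_gt0 p e; have := scaled_gt0 p' e'.
  case: s' s exy {fx fy} => [] [];
    rewrite ?expr1 ?expr0 ?mulN1r ?mul1r ?mulNr // => E; lra.
rewrite ss' -!mulrA in exy.
have s0 : (-1) ^+ s != 0 :> F by rewrite signr_eq0.
by have [-> ->] := canonical_uniq cx cy (mulfI s0 exy); rewrite ss'.
Qed.

Lemma SFval_sgn_same (b : bool) x y : finite x -> finite y ->
  val x = (-1) ^+ b * val y -> SFsame x (SFsgn b y).
Proof. by move=> fx fy e; apply: SFval_inj; rewrite ?SFfinite_sgn ?SFval_sgn. Qed.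

End Values.

(** * Nonzero pivots and the two assertions *)

Lemma upper_triangular_diag_neq0 (F : realType) k (T : 'M[F]_k) i :
  upper_triangular T -> T \in unitmx -> T i i != 0.
Proof.
move=> utT; rewrite unitmxE unitfE -det_tr det_trig // => /prodf_neq0.
by move=> /(_ i isT); rewrite mxE.
Qed.

Theorem proposition3p2 (R : realType) (k m : nat) :
  (forall (G : 'M[R]_(k + m)) (A : 'M[R]_(k + m, k))
      (J Jh : 'M[R]_(k + m)) (T Th : 'M[R]_k),
    spd G -> \rank A = k ->
    representation G A J T -> representation G A Jh Th ->
    forall nstar : 'cV[R]_(k + m),
      vec_z Jh nstar = vec_z J nstar /\ vec_r Jh Th nstar = vec_r J T nstar)
  /\
  (forall (prec emax : Z) (J Jh : 'M[spec_float]_(k + m))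
      (T Th : 'M[spec_float]_k) (s : 'rV[R]_k),
    float_format prec emax ->
    SFfinite_mx prec emax J -> SFfinite_mx prec emax Jh ->
    SFfinite_mx prec emax T -> SFfinite_mx prec emax Th ->
    upper_triangular (map_mx (@SFval R) T) ->
    map_mx (@SFval R) T \in unitmx ->
    (forall j, s 0 j = 1 \/ s 0 j = -1) ->
    map_mx (@SFval R) (lsubmx Jh) = map_mx (@SFval R) (lsubmx J) *m diag_mx s ->
    map_mx (@SFval R) (rsubmx Jh) = map_mx (@SFval R) (rsubmx J) ->
    map_mx (@SFval R) Th = diag_mx s *m map_mx (@SFval R) T ->
    forall (td : 'I_(k + m) -> sumexp 'I_(k + m))
      (tz : 'I_(k + m) -> sumexp 'I_m) (tr : 'I_k -> sumexp 'I_k),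
    (forall i, dot_scheme (td i)) ->
    (forall i, dot_scheme (tz i)) ->
    (forall i, row_scheme i (tr i)) ->
    forall nstar : 'cV[spec_float]_(k + m),
    SFfinite_mx prec emax nstar ->
      (forall i, SFsame (fl_z prec emax td tz Jh nstar i 0)
                        (fl_z prec emax td tz J nstar i 0)) /\
      (forall i, SFsame (fl_r prec emax td tr Jh Th nstar i 0)
                        (fl_r prec emax td tr J T nstar i 0))).
Proof.
split=> [G A J Jh T Th _ rankA rJ rJh n|].
  rewrite !(exact_vec_z rankA n rJ, exact_vec_z rankA n rJh).
  rewrite !(exact_vec_r rankA n rJ, exact_vec_r rankA n rJh).
  by rewrite (JJt_unique rJ rJh).
move=> prec emax J Jh T Th s _ fJ fJh fT fTh utT uT s1 hJ1 hJ2 hT td tz tr.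
move=> _ _ _ n _.
(* [b j] is the sign bit of $S_{jj}$. *)
pose b j := s 0 j == -1; have sE j : s 0 j = (-1) ^+ b j.
  rewrite /b; case: (s1 j) => ->; last by rewrite eqxx.
  by have /negPf-> : (1 : R) != -1 by rewrite -subr_eq0 opprK (pnatr_eq0 R 2).
have J1s i j : SFsame (Jh i (lshift m j)) (SFsgn (b j) (J i (lshift m j))).
  apply: (@SFval_sgn_same R _ _ _ _ _ (fJh _ _) (fJ _ _)).
  by have /matrixP/(_ i j) := hJ1; rewrite mul_mx_diag !mxE sE mulrC.
have J2s i j : SFsame (Jh i (rshift k j)) (J i (rshift k j)).
  apply: (@SFval_sgn_same R _ _ false _ _ (fJh _ _) (fJ _ _)).
  by have /matrixP/(_ i j) := hJ2; rewrite !mxE mul1r.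
have Ts i j : SFsame (Th i j) (SFsgn (b i) (T i j)).
  apply: (@SFval_sgn_same R _ _ _ _ _ (fTh _ _) (fT _ _)).
  by have /matrixP/(_ i j) := hT; rewrite mul_diag_mx !mxE sE.
split=> i.
  apply: (@fl_mulmxv_sgn _ _ _ _ _ _ _ _ _ false) => j.
    by rewrite !mxE; apply: J2s.
  rewrite !mxE; apply: (@sum_eval_sgn _ _ false) => // l.
    by rewrite !mxE; apply: J2s.
  exact: SFsame_refl.
apply: (@fl_solve_sgn _ _ _ _ _ _ _ _ b) => // [{}i|{}i].
  (* Entry [i] of $d_1$ involves only column [i] of $J_1$, hence the single sign [b i]. *)
  rewrite mxE [in X in SFsgn _ X]mxE; apply: fl_mulmxv_sgn => j.
    by rewrite !mxE; apply: J1s.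
  exact: SFsame_refl.
(* Zeros, infinities and NaN all have [SFval] equal to 0, so a nonzero value leaves only
   [S754_finite]. *)
have := upper_triangular_diag_neq0 i utT uT; rewrite mxE.
by case: (T i i) => //= [_|_|]; rewrite eqxx.
Qed.
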